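(* Assume $K_n$ has vertex set $\{v_1, v_2, \ldots, v_n\}$ and $f: V(K_n) \to \mathbb{Z}$ is a mapping with $f(v_1) \le f(v_2) \le \ldots \le f(v_n)$. Then $$m_c(K_n,f)=m_p(K_n,f)=\psi( \vec{x}(f) ).$$ In other words, for an integer $m \ge 0$, for $G=K_n \vee \overline{K_m}$, the following are equivalent: 1. $G$ is $f^{(m)}$-choosable. 2. $G$ is $f^{(m)}$-paintable. 3. $m < \psi(\vec{x}(f))$.
   Context: For graphs $G,H$, the join $G \vee H$ is obtained from the disjoint union of $G$ and $H$ by adding all edges between $V(G)$ and $V(H)$; $\overline{K_m}$ is the edgeless graph on $m$ vertices. For a graph $G$ and $f:V(G)\to\mathbb{N}$, $f^{(m)}$ is the extension of $f$ to $G \vee \overline{K_m}$ with $f^{(m)}(v)=|V(G)|$ for each vertex $v$ of $\overline{K_m}$; $m_c(G,f)$ (resp. $m_p(G,f)$) is the minimum $m$ such that $G \vee \overline{K_m}$ is not $f^{(m)}$-choosable (resp. not $f^{(m)}$-paintable). $G$ is $f$-choosable if it has a proper colouring from any lists $L(v)$ with $|L(v)|=f(v)$; $f$-paintable means Painter wins the online list colouring (painting) game with $f(v)$ tokens on each vertex $v$. For $\vec{x}=(x_1,\ldots,x_n)$ of nonnegative integers, an $\vec{x}$-dominated lattice path ending at $(a,b)$ is a lattice path from $(0,0)$ to $(a,b)$ using unit steps right $(1,0)$ and up $(0,1)$ such that every vertex $(i,j)$ on it satisfies $i \le x_{j+1}$; $\psi(\vec{x})$ is the number of $\vec{x}$-dominated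 lattice paths ending at $(x_n,n)$. For $f$ with $f(v_1)\le\cdots\le f(v_n)$, $\vec{x}(f)=(x_1,\ldots,x_n)$ with $x_i=f(v_i)-i$. *)

(* Defs.v *)
From HB Require Import structures.
From mathcomp Require Import all_boot all_order all_algebra.

Set Implicit Arguments.
Unset Strict Implicit.
Unset Printing Implicit Defensive.

Import Order.TTheory GRing.Theory Num.Theory.
Local Open Scope ring_scope.

Record sgraph := SGraph {
  vertex :> finType;
  adj : rel vertex;
  adj_sym : symmetric adj;
  adj_irrefl : irreflexive adj
}.

Section CompleteEdgeless.
Variable n : nat.

Definition complete_adj : rel 'I_n := fun u v => u != v.

Fact complete_sym : symmetric complete_adj.
Proof. by move=> u v; rewrite /complete_adj eq_sym. Qed.

Fact complete_irrefl : irreflexive complete_adj.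
Proof. by move=> u; rewrite /complete_adj eqxx. Qed.

Definition complete_graph : sgraph := SGraph complete_sym complete_irrefl.

Definition edgeless_adj : rel 'I_n := fun _ _ => false.

Fact edgeless_sym : symmetric edgeless_adj.
Proof. by []. Qed.

Fact edgeless_irrefl : irreflexive edgeless_adj.
Proof. by []. Qed.

Definition edgeless_graph : sgraph := SGraph edgeless_sym edgeless_irrefl.

End CompleteEdgeless.

Section Join.
Variables G H : sgraph.

Definition join_adj : rel (G + H)%type := fun u v =>
  match u, v with
  | inl a, inl b => adj a b
  | inr a, inr b => adj a b
  | _, _ => true
  end.

Fact join_sym : symmetric join_adj.
Proof. by move=> [a|a] [b|b] //=; apply: adj_sym. Qed.

Fact join_irrefl : irreflexive join_adj.
Proof. by move=> [a|a] /=; apply: adj_irrefl. Qed.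

Definition join_graph : sgraph := SGraph join_sym join_irrefl.

End Join.

Definition join_edgeless (G : sgraph) (m : nat) : sgraph :=
  join_graph G (edgeless_graph m).

(* The map f^(m). *)
Definition extend_map (G : sgraph) (m : nat) (f : G -> int) :
    join_edgeless G m -> int :=
  fun v => match v with inl u => f u | inr _ => #|G|%:Z end.
Arguments extend_map {G} m f v.

Section Colouring.
Variable G : sgraph.
Implicit Types (f : G -> int) (U M X : {set G}).

Definition independent X : Prop := {in X &, forall u v, ~~ adj u v}.

(* Since f is integer valued, a negative f v is read as 0 (an empty list);   *)
(* otherwise no list would have size f v, and G would be f-choosable         *)
(* vacuously. A finite graph only uses finitely many colours in its lists.   *)
Definition choosable f : Prop :=
  forall (C : finType) (L : G -> {set C}),
    (forall v, #|L v|%:Z = Num.max (f v) 0) ->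
    exists2 c : G -> C, (forall v, c v \in L v) &
                        (forall u v, adj u v -> c u != c v).

(* Painter wins from the position where U is the set of uncoloured vertices  *)
(* and each v in U has f v tokens left. Painter loses as soon as an          *)
(* uncoloured vertex has no token left. In a round, Lister marks a nonempty  *)
(* set M of uncoloured vertices and takes one token from each of them, and   *)
(* Painter colours an independent subset X of M. Each round uses up a token, *)
(* so every play is finite.                                                  *)
Inductive painter_wins : {set G} -> (G -> int) -> Prop :=
| PainterDone f : painter_wins set0 f
| PainterRound U f :
    (forall v, v \in U -> 0 < f v) ->
    (forall M, M \subset U -> M != set0 ->
       exists X, [/\ X \subset M, independent X &
         painter_wins (U :\: X)
           (fun v => if v \in M then f v - 1 else f v)]) ->
    painter_wins U f.

Definition paintable f : Prop := painter_wins [set: G] f.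

End Colouring.

Definition is_minimum (P : nat -> Prop) (k : nat) : Prop :=
  P k /\ (forall m, P m -> (k <= m)%N).

(* k = m_c(G, f) *)
Definition is_mc (G : sgraph) (f : G -> int) (k : nat) : Prop :=
  is_minimum (fun m => ~ choosable (extend_map m f)) k.

(* k = m_p(G, f) *)
Definition is_mp (G : sgraph) (f : G -> int) (k : nat) : Prop :=
  is_minimum (fun m => ~ paintable (extend_map m f)) k.

(* A lattice path from (0, 0) is its sequence of steps, true being a right   *)
(* step and false an up step; this is its vertex after k steps.              *)
Definition path_vertex (p : seq bool) (k : nat) : nat * nat :=
  (count_mem true (take k p), count_mem false (take k p)).

(* x is indexed from 0, so that x`_j is x_(j+1). As x_(n+1) does *)
(* not exist, there is no constraint on the vertices at height n = size x.   *)
Definition dominated (x : seq int) (p : seq bool) : bool :=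
  all (fun k => let: (i, j) := path_vertex p k in
                (j < size x)%N ==> (i%:Z <= x`_j))
      (iota 0 (size p).+1).

Definition num_dominated (x : seq int) (a b : nat) : nat :=
  #|[set p : (a + b).-tuple bool |
      (path_vertex p (a + b) == (a, b)) && dominated x p]|.

(* No lattice path ends at (x_n, n) when x_n < 0. *)
Definition psi (x : seq int) : nat :=
  if last 0 x is Posz a then num_dominated x a (size x) else 0%N.

(* The vertex v_i of K_n is the ordinal of value i - 1. *)
Definition xvec (n : nat) (f : complete_graph n -> int) : seq int :=
  [seq f i - (i.+1)%:Z | i : 'I_n].

(* Main.v *)
(* Reading an up step in position c as "colour c is used on K_n", the paths   *)
(* counted by psi are the n-subsets S of {0, ..., f(v_n) - 1} such that, for  *)
(* every k, S has at least #{u | f u <= k} elements below k: these are the    *)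
(* sets of colours available to the clique when L(v_i) = {0, ..., f(v_i)-1}.  *)
(* If m is at least their number, giving each such S as a list to one of the  *)
(* m independent vertices blocks every colouring. Conversely, let N(U, f) be  *)
(* the number of such sets for the uncoloured part U of the clique. Painter   *)
(* keeps N(U, f) above the number of critical independent vertices, those     *)
(* having exactly #|U| tokens left. If Lister marks the nonempty set A in the *)
(* clique and v minimises f on A, then                                        *)
(*   N(U, f) <= N(U, f - 1_A) + N(U - v, f - 1_A),                            *)
(* so Painter can either colour v, after which the unmarked critical vertices *)
(* are no longer critical, or colour all marked independent vertices.         *)
Require Import Defs.
From HB Require Import structures.
From mathcomp Require Import all_boot all_order all_algebra.
From mathcomp Require Import zify.

Set Implicit Arguments.
Unset Strict Implicit.
Unset Printing Implicit Defensive.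

Import Order.TTheory GRing.Theory Num.Theory.
Local Open Scope ring_scope.

(** The three statements are proved in a cycle. Paintable implies choosable because Lister can
    replay any list assignment, one colour per round ([painter_wins_colouring]). Choosable implies
    [m < psi (xvec f)] because otherwise lists can be chosen that block every colouring of the
    clique ([not_choosable_join]). That bound implies paintable by Painter's invariant
    ([painter_wins_join]), which survives each round by the recursive inequality
    [num_admissible_round]. [psi_xvec] identifies the count in the invariant with the number of
    lattice paths, and both minima follow. *)

(** * Painting simulates list colouring *)

Section PaintableChoosable.
Variable G : sgraph.
Implicit Types (f : G -> int) (U M X : {set G}).

Lemma painter_wins_gt0 U f :
  painter_wins U f -> forall v, v \in U -> 0 < f v.
Proof. by case=> [f' v|U' f' f'_gt0 _] //; rewrite inE. Qed.

Lemma painter_wins_round U f M :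
    painter_wins U f -> M \subset U -> M != set0 ->
  exists X, [/\ X \subset M, independent X &
    painter_wins (U :\: X) (fun v => if v \in M then f v - 1 else f v)].
Proof.
case=> [f'|U' f' _ round]; last exact: round.
by rewrite subset0 => ->.
Qed.

(** Induction on the available colours [Cs]: offering a colour [a] is the round in which Lister
    marks the vertices of [U] whose list contains [a], and Painter's reply becomes the colour class
    of [a]. A list loses [a] exactly when its vertex loses a token, so the bound on [f] persists. *)
Lemma painter_wins_colouring (C : finType) (c0 : G -> C) (L : G -> {set C}) U f
    (Cs : {set C}) :
    painter_wins U f -> (forall v, v \in U -> f v <= #|L v|%:Z) ->
    (forall v, L v \subset Cs) ->
  exists2 c : G -> C, {in U, forall v, c v \in L v} &
    {in U &, forall u v, adj u v -> c u != c v}.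
Proof.
have [k leCsk] := ubnP #|Cs|; elim: k => // k IHk in Cs leCsk L U f *.
move=> winsU fL LCs.
have [Cs0|[a aCs]] := set_0Vmem Cs.
  suff -> : U = set0 by exists c0 => [v|u v]; rewrite inE.
  apply/setP=> v; rewrite inE; apply/negP=> Uv.
  have := fL v Uv; have := LCs v; rewrite Cs0 subset0 => /eqP->.
  by rewrite cards0 leNgt (painter_wins_gt0 winsU).
have ltCsk : (#|Cs :\ a| < k)%N by rewrite [#|Cs|](cardsD1 a) aCs in leCsk.
have L'Cs v : L v :\ a \subset Cs :\ a by rewrite setSD.
have cardL v : (#|L v|%:Z = (a \in L v)%:Z + #|L v :\ a|%:Z).
  by rewrite [#|L v|](cardsD1 a) PoszD.
pose M := [set v in U | a \in L v].
(* A colour in no list of [U] is dropped without a round, since Lister must mark a nonempty set. *)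
have [M0|Mn0] := eqVneq M set0.
  have [|c cL cadj] := IHk _ ltCsk (fun v => L v :\ a) U f winsU _ L'Cs.
    move=> v Uv; have := fL v Uv; rewrite cardL.
    by have := in_set0 v; rewrite -M0 inE Uv /= => ->.
  by exists c => // v /cL; rewrite inE => /andP[].
have MU : M \subset U by apply/subsetP=> v; rewrite inE => /andP[].
have [X [XM indX winsX]] := painter_wins_round winsU MU Mn0.
have [|c cL cadj] := IHk _ ltCsk (fun v => L v :\ a) _ _ winsX _ L'Cs.
  move=> v; rewrite !inE => /andP[_ Uv]; have := fL v Uv.
  by rewrite cardL Uv /=; case: (a \in L v) => //; rewrite ?add0r // lerBlDl.
exists (fun v => if v \in X then a else c v) => [v Uv|u v Uu Uv uv].
  have [/(subsetP XM)|nXv] := boolP (v \in X); first by rewrite inE => /andP[].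
  by have := cL v; rewrite !inE nXv Uv => /(_ isT)/andP[].
have cNa w : w \in U -> w \notin X -> c w != a.
  by move=> Uw nXw; have := cL w; rewrite !inE nXw Uw => /(_ isT)/andP[].
have [Xu|nXu] := boolP (u \in X); have [Xv|nXv] := boolP (v \in X).
- by have := indX u v Xu Xv; rewrite uv.
- by rewrite eq_sym cNa.
- by rewrite cNa.
- by apply: cadj; rewrite // inE ?nXu ?nXv.
Qed.

Lemma paintable_choosable f : paintable f -> choosable f.
Proof.
move=> winsT C L cardL.
have Ln0 v : exists a, a \in L v.
  apply/set0Pn; rewrite -card_gt0 -ltz_nat cardL.
  by have := painter_wins_gt0 winsT (in_setT v); lia.
have [||c cL cadj] := @painter_wins_colouring C (fun v => xchoose (Ln0 v)) L
  [set: G] f [set: C] winsT.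
- by move=> v _; rewrite cardL le_max lexx.
- by move=> v; rewrite subsetT.
by exists c => [v|u v uv]; [apply: cL | apply: cadj]; rewrite ?inE.
Qed.

End PaintableChoosable.

(* The number of up steps, encoded as in path_vertex by false, among the      *)
(* first k steps of p; steps beyond the end of p count as right steps.        *)
Definition ups (p : seq bool) (k : nat) : nat :=
  (\sum_(i < k) ~~ nth true p i)%N.

Lemma upsS p k : ups p k.+1 = (ups p k + ~~ nth true p k)%N.
Proof. by rewrite /ups big_ord_recr. Qed.

Lemma ups0 p : ups p 0 = 0%N.
Proof. by rewrite /ups big_ord0. Qed.

Lemma ups_oversize p k : (size p <= k)%N -> ups p k = ups p (size p).
Proof.
elim: k => [|k IHk]; first by rewrite leqn0 => /eqP->.
rewrite leq_eqVlt => /predU1P[->//|ltpk].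
by rewrite upsS nth_default // addn0 IHk.
Qed.

Lemma ups_take p k : ups p k = count_mem false (take k p).
Proof.
have [lepk|] := leqP (size p) k; last first.
  elim: k => [|k IHk ltkp]; first by rewrite take0 ups0.
  rewrite upsS IHk ?(ltnW ltkp) // (take_nth true) ?(ltnW ltkp) //.
  by rewrite -cats1 count_cat /=; case: nth.
rewrite take_oversize // ups_oversize // {lepk k}.
elim/last_ind: p => [|p b IHp]; first by rewrite ups0.
rewrite size_rcons upsS -cats1 count_cat -IHp nth_cat ltnn subnn /= addn0.
congr (_ + _)%N; last by case: b.
by apply: eq_bigr => i _; rewrite nth_cat ltn_ord.
Qed.

Lemma count_true_ups p k :
  (k <= size p)%N -> (count_mem true (take k p) + ups p k)%N = k.
Proof.
move=> lekp; rewrite ups_take -[RHS](size_takel lekp).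
rewrite -(count_predC (pred1 true)).
by congr addn; apply: eq_count; case.
Qed.

Lemma ups_le p k : (ups p k <= k)%N.
Proof. by elim: k => [|k IHk]; rewrite ?ups0 // upsS; lia. Qed.

Lemma card_ups N p : #|[set c : 'I_N | ~~ nth true p c]| = ups p N.
Proof.
by rewrite -sum1dep_card big_mkcond; apply: eq_bigr => c _; case: nth.
Qed.

Lemma card_ord_lt n k : (k <= n)%N -> #|[set i : 'I_n | (i < k)%N]| = k.
Proof.
by move=> lekn; rewrite -sum1dep_card (big_ord_narrow lekn) sum1_card card_ord.
Qed.

(** * Deleting one step of a path *)

Section Deletion.
Variables (K a : nat).
Implicit Types p : K.-tuple bool.

(* Deletes step a; a right step is appended to keep the length. *)
Definition del p : K.-tuple bool := [tuple nth true p (bump a i) | i < K].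

Lemma nth_del p i : nth true (del p) i = nth true p (bump a i).
Proof.
have [leKi|ltiK] := leqP K i; last first.
  by rewrite -[i]/(nat_of_ord (Ordinal ltiK)) -tnth_nth tnth_mktuple.
by rewrite !nth_default ?size_tuple // (leq_trans leKi) // leq_addl.
Qed.

Lemma ups_del_le p k : (k <= a)%N -> ups (del p) k = ups p k.
Proof.
move=> leka; apply: eq_bigr => i _.
by rewrite nth_del /bump leqNgt (leq_trans (ltn_ord i)).
Qed.

Lemma ups_del_ge p k :
  (a <= k)%N -> (ups (del p) k + ~~ nth true p a)%N = ups p k.+1.
Proof.
elim: k => [|k IHk]; first by rewrite leqn0 => /eqP->; rewrite upsS !ups0.
rewrite leq_eqVlt => /predU1P[<-|ltak]; first by rewrite upsS ups_del_le.
by rewrite upsS nth_del /bump -ltnS ltak addnAC IHk // [RHS]upsS.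
Qed.

Lemma del_inj b :
  {in [pred p : K.-tuple bool | nth true p a == b] &, injective del}.
Proof.
move=> p q; rewrite !inE => /eqP pa /eqP qa eq_del.
apply/eq_from_tnth=> i; rewrite !(tnth_nth true).
have [->|nia] := eqVneq (i : nat) a; first by rewrite pa.
by rewrite -(unbumpK (h := a) (x := i)) ?inE // -!nth_del eq_del.
Qed.

End Deletion.

(** * Admissible colour sets and their recursion *)

Section Admissible.
Variables (T : finType) (K : nat).
Implicit Types (U A : {set T}) (f g : T -> int) (p : K.-tuple bool).

Definition num_le U f (k : nat) : nat := #|[set u in U | f u <= k%:Z]|.

(** This is Hall's condition for matching [U] bijectively with the up positions of [p] so that [u]
    gets a position below [f u]; the allowed sets are nested, so thresholds suffice. *)
Definition admissible U f p :=
  (ups p K == #|U|) && [forall k : 'I_K, num_le U f k <= ups p k]%N.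

Definition num_admissible U f : nat := #|[set p | admissible U f p]|.

Lemma admissibleP U f p :
  reflect (ups p K = #|U| /\ forall k, (num_le U f k <= ups p k)%N)
          (admissible U f p).
Proof.
apply: (iffP andP) => [[/eqP cardU /forallP leU]|[-> leU]]; last first.
  by split=> //; apply/forallP.
split=> // k; have [leKk|ltkK] := leqP K k; last exact: (leU (Ordinal ltkK)).
rewrite ups_oversize size_tuple // cardU subset_leq_card //.
by apply/subsetP=> u; rewrite inE => /andP[].
Qed.

Lemma eq_num_admissible U f g :
  {in U, f =1 g} -> num_admissible U f = num_admissible U g.
Proof.
move=> eq_fg; apply: eq_card => p; rewrite !inE /admissible; congr (_ && _).
apply: eq_forallb => k; congr (_ <= _)%N; apply: eq_card => u; rewrite !inE.
by case: (boolP (u \in U)) => // /eq_fg->.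
Qed.

Lemma num_admissible_gt0 U f u :
  (0 < num_admissible U f)%N -> u \in U -> 0 < f u.
Proof.
case/card_gt0P=> p; rewrite inE => /admissibleP[_ /(_ 0%N)].
rewrite ups0 leqn0 cards_eq0 => /eqP/setP/(_ u); rewrite !inE ltNge.
by move=> + Uu; rewrite Uu /= => ->.
Qed.

Lemma num_admissible0 f : (num_admissible set0 f <= 1)%N.
Proof.
apply/card_le1P => p; rewrite !inE => /admissibleP[p0 _] q; rewrite !inE.
have allT r : ups r K = 0%N -> forall i, (i < K)%N -> nth true r i = true.
  move=> /eqP; rewrite sum_nat_eq0 => /forallP r0 i ltiK.
  by have := r0 (Ordinal ltiK); rewrite /= eqb0 negbK.
rewrite cards0 in p0; apply/idP/eqP => [/admissibleP[]|->].
  rewrite cards0 => q0 _; apply/eq_from_tnth=> i.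
  by rewrite !(tnth_nth true) !allT.
apply/admissibleP; rewrite cards0; split=> // k.
by rewrite (@leq_trans 0) // leqn0 cards_eq0; apply/eqP/setP=> u; rewrite !inE.
Qed.

(* Deleting the step in position f v - 1 maps the admissible sequences for    *)
(* (U, f) to those for (U, g) or (U :\ v, g), according to that step.         *)
Lemma num_admissible_round U A f g v :
    A \subset U -> v \in A -> 0 < f v -> {in A, forall u, f v <= f u} ->
    {in U, forall u, g u = f u - (u \in A)%:Z} ->
  (num_admissible U f <= num_admissible U g + num_admissible (U :\ v) g)%N.
Proof.
move=> AU Av fv_gt0 minfv gE.
have [a fv] : exists a : nat, f v = a.+1 by exists `|f v|.-1%N; lia.
have Uv := subsetP AU v Av.
pose S (b : bool) : {set K.-tuple bool} :=
  [set p in [set p | admissible U f p] | nth true p a == b].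
have -> : num_admissible U f = (#|S true| + #|S false|)%N.
  rewrite /num_admissible.
  rewrite -(cardsID [set p : K.-tuple bool | nth true p a == true]).
  by congr addn; apply: eq_card => p; rewrite !inE // andbC; case: nth.
have del_S b V : {in S b, forall p, admissible V g (del a p)} ->
    (#|S b| <= num_admissible V g)%N.
  move=> adm_del; rewrite -(card_in_imset (f := del a) (D := S b)).
    by apply/subset_leq_card/subsetP=> _ /imsetP[p Sp ->]; rewrite inE adm_del.
  move=> p q; rewrite !inE => /andP[_ pa] /andP[_ qa].
  exact: (@del_inj _ _ b).
(* A marked [u] has [g u >= f v - 1 = a], so under [g] no threshold below [a] counts it. *)
have le_num_lt k : (k < a)%N -> (num_le U g k <= num_le U f k)%N.
  move=> ltka; apply/subset_leq_card/subsetP=> u; rewrite !inE => /andP[Uu].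
  rewrite gE // Uu /=; case: (boolP (u \in A)) => [/minfv|_]; rewrite ?fv; lia.
have le_num_ge k : (num_le U g k <= num_le U f k.+1)%N.
  apply/subset_leq_card/subsetP=> u; rewrite !inE => /andP[Uu].
  rewrite gE // Uu /=; lia.
(* The strict drop pays for the deleted up step: [v] is counted on the right only. *)
have lt_num_ge k : (a <= k)%N -> (num_le (U :\ v) g k < num_le U f k.+1)%N.
  move=> leak; rewrite /num_le [#|[set u in U | _]|](cardsD1 v) inE Uv fv /=.
  rewrite lez_nat ltnS leak add1n ltnS.
  apply/subset_leq_card/subsetP=> u; rewrite !inE => /andP[/andP[-> Uu]].
  rewrite gE // Uu /=; lia.
have le_numD1 k : (num_le (U :\ v) g k <= num_le U g k)%N.
  by apply/subset_leq_card/subsetP=> u; rewrite !inE => /andP[/andP[_ ->]].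
have upsK p b : nth true p a = b -> (ups (del a p) K + ~~ b)%N = ups p K.
  move=> pa; have [leaK|ltKa] := leqP a K.
    by rewrite -pa ups_del_ge // ups_oversize size_tuple.
  rewrite ups_del_le ?(ltnW ltKa) // -pa nth_default ?addn0 //.
  by rewrite size_tuple ltnW.
apply: leq_add; apply: del_S => p; rewrite !inE;
  move=> /andP[/admissibleP[cardU leU] /eqP pa];
  apply/admissibleP; split=> [|k].
- by rewrite -cardU -(upsK _ _ pa) addn0.
- have [leak|ltka] := leqP a k.
    have := ups_del_ge p leak; rewrite pa addn0 => ->.
    exact: leq_trans (le_num_ge k) (leU _).
  by rewrite ups_del_le ?(ltnW ltka) // (leq_trans (le_num_lt _ ltka)).
- by move: cardU; rewrite -(upsK _ _ pa) [#|U|](cardsD1 v) Uv addnC => -[].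
have [leak|ltka] := leqP a k.
  have := ups_del_ge p leak; rewrite pa addn1 => eq_ups.
  by rewrite -ltnS eq_ups (leq_trans (lt_num_ge _ leak)).
rewrite ups_del_le ?(ltnW ltka) // (leq_trans (le_numD1 k)) //.
exact: leq_trans (le_num_lt _ ltka) (leU _).
Qed.

End Admissible.

(** * Painter's strategy on the join *)

Section PainterStrategy.
Variables (H : sgraph) (m K : nat).
Let G := join_edgeless H m.
Implicit Types (U M X : {set G}) (f : G -> int).

Definition core U : {set H} := [set u | inl u \in U].

Definition critical U f : {set 'I_m} :=
  [set w | (inr w \in U) && (f (inr w) <= #|core U|%:Z)].

(** The two hypotheses are Painter's invariant; [good X] says that the reply [X] restores it, and
    the tokens left on [U] decrease. Core vertices are coloured one at a time, so [H] can be any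
    graph. *)
Lemma painter_wins_join U f :
    (forall w, inr w \in U -> #|core U|%:Z <= f (inr w)) ->
    (#|critical U f| < num_admissible K (core U) (f \o inl))%N ->
  painter_wins U f.
Proof.
have [k ltUk] := ubnP (\sum_(v in U) `|f v|)%N.
elim: k => // k IHk in U f ltUk * => geU ltU.
have f_gt0 v : v \in U -> 0 < f v.
  case: v => [u|w] Uv.
    apply: (@num_admissible_gt0 _ K (core U) (f \o inl)); last by rewrite inE.
    exact: leq_ltn_trans ltU.
  (* With no core vertex left, at most one sequence is admissible, so no vertex is critical, that
     is, none is out of tokens. *)
  have := geU w Uv; case: (posnP #|core U|) => [|]; last by lia.
  move=> /eqP; rewrite cards_eq0 => /eqP core0.
  move: ltU; rewrite core0 cards0 => ltU le0w; rewrite lt_neqAle le0w andbT.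
  apply/eqP=> fw0; have := num_admissible0 K (f \o inl : H -> int).
  suff : (0 < #|critical U f|)%N by lia.
  by apply/card_gt0P; exists w; rewrite inE Uv core0 cards0 -fw0.
apply: PainterRound => // M MU Mn0.
pose g v := if v \in M then f v - 1 else f v.
pose good X := [/\ X \subset M, independent X,
    forall w, inr w \in U :\: X -> #|core (U :\: X)|%:Z <= g (inr w) &
    (#|critical (U :\: X) g| < num_admissible K (core (U :\: X)) (g \o inl))%N].
suff [X [XM indX geX ltX]] : exists X, good X.
  exists X; split=> //; apply: IHk => //.
  rewrite -ltnS (leq_trans _ ltUk) // ltnS.
  have [x Mx] := set0Pn _ Mn0; have Ux := subsetP MU x Mx.
  apply: (@leq_ltn_trans (\sum_(v in U) `|g v|)%N).
    by rewrite [leqRHS](big_setID X) leq_addl.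
  rewrite (bigD1 x Ux) [ltnRHS](bigD1 x Ux) /= -addSn leq_add //.
    by rewrite /g Mx; have := f_gt0 x Ux; lia.
  apply: leq_sum => v /andP[Uv _]; have := f_gt0 v Uv.
  by rewrite /g; case: ifP; lia.
pose Mcrit := [set w in critical U f | inr w \in M].
pose XB := [set x in M | if x is inr _ then true else false].
have coreB : core (U :\: XB) = core U by apply/setP=> u; rewrite !inE andbF.
have goodB :
    (#|critical U f :\: Mcrit| < num_admissible K (core U) (g \o inl))%N ->
  exists X, good X.
  move=> ltB; exists XB; rewrite /good coreB; split.
  - by apply/subsetP=> x; rewrite inE => /andP[].
  - by move=> [u|w] [u'|w']; rewrite !inE ?andbF.
  - move=> w; rewrite !inE andbT => /andP[nMw Uw].
    by rewrite /g (negPf nMw) geU.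
  apply: leq_ltn_trans ltB; apply/subset_leq_card/subsetP=> w.
  rewrite !inE coreB andbT => /andP[/andP[nMw Uw]].
  by rewrite /g (negPf nMw) Uw andbF => ->.
(* If only independent vertices are marked, the admissible count is unchanged and colouring them all
   is safe. *)
have [core0|[v0 Mv0]] := set_0Vmem (core M).
  apply: goodB; apply: leq_ltn_trans (subset_leq_card (subsetDl _ _)) _.
  rewrite (eq_num_admissible _ (f := g \o inl) (g := f \o inl)) // => u _ /=.
  by rewrite /g; have := in_set0 u; rewrite -core0 inE => ->.
have [v Mv minv] : exists2 v, v \in core M &
    {in core M, forall u, f (inl v) <= f (inl u)}.
  by case: (@arg_minP _ _ _ v0 [in core M] (f \o inl) Mv0) => v; exists v.
have coreMU : core M \subset core U.
  by apply/subsetP=> u; rewrite !inE => /(subsetP MU).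
have Uv := subsetP coreMU v Mv.
have fv_gt0 : 0 < f (inl v) by apply: f_gt0; rewrite inE in Uv.
have gE :
  {in core U, forall u, (g \o inl) u = (f \o inl) u - (u \in core M)%:Z}.
  by move=> u _; rewrite /= /g inE; case: (inl u \in M); rewrite ?subr0.
have := leq_trans ltU (num_admissible_round K coreMU Mv fv_gt0 minv gE).
have [ltM _|leM le_round] :=
  ltnP #|Mcrit| (num_admissible K (core U :\ v) (g \o inl)).
  (* Colour [v]: the core shrinks by one, so unmarked vertices have a token to spare and only those
     of [Mcrit] can still be critical. *)
  have coreA : core (U :\ inl v) = core U :\ v by apply/setP=> u; rewrite !inE.
  have cardU : #|core U| = #|core U :\ v|.+1 by rewrite (cardsD1 v) Uv.
  exists [set inl v]; rewrite /good coreA; split.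
  - by rewrite sub1set; rewrite inE in Mv.
  - by move=> x y; rewrite !inE => /eqP-> /eqP->; rewrite adj_irrefl.
  - move=> w; rewrite !inE /= => Uw; have := geU w Uw.
    by rewrite cardU /g; move: #|_| (f _) => c t; case: ifP => _; lia.
  apply: leq_ltn_trans ltM; apply/subset_leq_card/subsetP=> w.
  rewrite !inE coreA /= => /andP[Uw]; rewrite Uw; have := geU w Uw.
  by rewrite cardU /g; move: #|_| (f _) => c t; case: ifP => _; lia.
(* [Mcrit] has at least as many vertices as the second term of the recursion, so colouring it leaves
   fewer critical vertices than the first term. *)
apply: goodB.
have McritU : Mcrit \subset critical U f.
  by apply/subsetP=> w; rewrite inE => /andP[].
have := subset_leq_card McritU; rewrite cardsDS //; lia.
Qed.

End PainterStrategy.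

(** * Lists that block every colouring *)

Section Lister.
Variables (n m K : nat) (f : complete_graph n -> int).

Lemma not_choosable_join :
    (forall i, f i <= K%:Z) -> (num_admissible K [set: 'I_n] f <= m)%N ->
  ~ choosable (extend_map m f).
Proof.
move=> lefK leNm chG.
pose p0 : K.-tuple bool := [tuple of nseq K true].
pose adm := enum [set p : K.-tuple bool | admissible [set: 'I_n] f p].
(* Filler list for the vertices beyond the number of admissible sets; having [K + n] colours ensures
   that [n] of them exist. *)
pose init : {set 'I_(K + n)} := [set c : 'I_(K + n) | (c < n)%N].
pose blocker (w : 'I_m) : {set 'I_(K + n)} :=
  if (w < size adm)%N then [set c : 'I_(K + n) | ~~ nth true (nth p0 adm w) c]
  else init.
pose L (v : join_edgeless (complete_graph n) m) : {set 'I_(K + n)} :=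
  match v with
  | inl i => [set c : 'I_(K + n) | c%:Z < f i]
  | inr w => blocker w
  end.
have cardL v : #|L v|%:Z = Num.max (extend_map m f v) 0.
  case: v => [i|w] /=.
    have := lefK i; case fi: (f i) => [k|k] lekK.
      by rewrite -[in RHS](@card_ord_lt (K + n) k) ?max_l //; lia.
    by rewrite max_r //; congr Posz; apply: eq_card0 => c; rewrite !inE.
  rewrite max_l // card_ord; congr Posz; rewrite /blocker.
  case: ifP => [ltw|_]; last by rewrite card_ord_lt ?leq_addl.
  have : nth p0 adm w \in adm by rewrite mem_nth.
  rewrite mem_enum inE => /admissibleP[].
  rewrite cardsT card_ord => cardn _.
  by rewrite card_ups ups_oversize size_tuple ?leq_addr.
have [c cL cadj] := chG _ L cardL.
(* The up steps of [q] are the colours used on the clique. These are distinct and that of [i] lies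
   below [f i], so [q] is admissible and some blocker list is exactly this set. *)
pose q : K.-tuple bool := [tuple [forall i, c (inl i) != b :> nat] | b < K].
have qE b : nth true q b = [forall i, c (inl i) != b :> nat].
  have [leKb|ltbK] := leqP K b; last first.
    by rewrite -[b]/(nat_of_ord (Ordinal ltbK)) -tnth_nth tnth_mktuple.
  rewrite nth_default ?size_tuple //; apply/esym/forallP=> i; apply/eqP=> cib.
  by have := cL (inl i); have := lefK i; rewrite /= inE cib; lia.
have c_inj : injective (fun i => c (inl i)).
  by move=> i j; apply: contra_eq; apply: (cadj (inl i) (inl j)).
have ups_q k : ups q k = #|[set i | (c (inl i) < k)%N]|.
  elim: k => [|k IHk].
    by rewrite ups0; apply/esym/eq_card0 => i; rewrite !inE.
  rewrite upsS IHk qE; case: (boolP [forall i, _]) => [/forallP nck|].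
    by rewrite addn0; apply: eq_card => i; rewrite !inE ltnS ltn_neqAle nck.
  rewrite negb_forall => /existsP[i]; rewrite negbK => /eqP cik.
  rewrite addn1 [RHS](cardsD1 i) inE cik ltnSn add1n; congr _.+1.
  apply: eq_card => j; rewrite !inE ltnS ltn_neqAle -cik; congr (~~ _ && _).
  by rewrite (inj_eq val_inj) (inj_eq c_inj).
have adm_q : q \in adm.
  rewrite mem_enum inE; apply/admissibleP; split=> [|k].
    rewrite ups_q; congr #|pred_of_set _|; apply/setP=> i; rewrite !inE.
    by have := cL (inl i); have := lefK i; rewrite /= inE; lia.
  rewrite ups_q; apply/subset_leq_card/subsetP=> i; rewrite !inE /= => lefk.
  by have := cL (inl i); rewrite /= inE; lia.
have lt_qm : (index q adm < m)%N.
  by rewrite (leq_trans _ leNm) // /num_admissible cardE index_mem.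
have := cL (inr (Ordinal lt_qm)); rewrite /= /blocker /= index_mem adm_q.
rewrite inE nth_index // qE negb_forall => /existsP[i].
rewrite negbK => /eqP cic.
have := cadj (inl i) (inr (Ordinal lt_qm)) isT.
by move/eqP; apply; apply: val_inj.
Qed.

End Lister.

(** * Admissible sequences as dominated lattice paths *)

Section LatticePaths.
Variables (n : nat) (f : complete_graph n.+1 -> int).
Hypothesis f_mono : forall i j : 'I_n.+1, (i <= j)%N -> f i <= f j.

(** As [f] is sorted, the vertices with value at most [k] form an initial segment. *)
Lemma num_le_sorted (k : nat) (j : 'I_n.+1) :
  (num_le [set: 'I_n.+1] f k <= j)%N = (k%:Z < f j).
Proof.
apply/idP/idP => [|ltkf]; last first.
  rewrite -[leqRHS](@card_ord_lt n.+1) ?(ltnW (ltn_ord j)) //.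
  apply/subset_leq_card/subsetP=> i; rewrite !inE /= ltnNge => lefk.
  by apply/negP=> /f_mono; lia.
apply: contraLR; rewrite -leNgt -ltnNge => lefk.
rewrite -[leqLHS](@card_ord_lt n.+1) //.
apply/subset_leq_card/subsetP=> i; rewrite !inE ltnS => /f_mono; lia.
Qed.

Lemma nth_xvec (j : 'I_n.+1) : (xvec f)`_j = f j - (j.+1)%:Z.
Proof.
by rewrite (nth_map j) ?nth_ord_enum // size_enum_ord.
Qed.

Lemma size_xvec : size (xvec f) = n.+1.
Proof. by rewrite size_map size_enum_ord. Qed.

(** After [k] steps the path is at [(i, j)] with [i + j = k], so for an ordinal [j] the bound
    [i <= f j - j.+1] reads [k < f j]. At height [n.+1] or above, neither side imposes anything. *)
Lemma dominated_xvec (p : seq bool) :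
  dominated (xvec f) p =
  [forall k : 'I_(size p).+1, num_le [set: 'I_n.+1] f k <= ups p k]%N.
Proof.
have domk k : (k <= size p)%N ->
    (let: (i, j) := path_vertex p k in
     (j < size (xvec f))%N ==> (i%:Z <= (xvec f)`_j)) =
    (num_le [set: 'I_n.+1] f k <= ups p k)%N.
  move=> lekp; rewrite /path_vertex -ups_take size_xvec.
  have := count_true_ups lekp; set i := count_mem true _.
  have [ltj eqk|lej _] := ltnP (ups p k) n.+1; last first.
    by apply/esym/(leq_trans _ lej); rewrite -[leqRHS]card_ord max_card.
  by rewrite (nth_xvec (Ordinal ltj)) (num_le_sorted k (Ordinal ltj)) /=; lia.
apply/allP/forallP => [dom [k ltk]|dom k].
  by rewrite -domk //; apply: dom; rewrite mem_iota.
rewrite mem_iota add0n => /andP[_ ltk].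
by rewrite domk //; apply: (dom (Ordinal ltk)).
Qed.

Lemma psi_xvec :
  psi (xvec f) = num_admissible `|Num.max (f ord_max) 0|%N [set: 'I_n.+1] f.
Proof.
rewrite /psi.
have -> : last 0 (xvec f) = f ord_max - n.+1%:Z.
  by rewrite (last_nth 0) size_xvec -(nth_xvec ord_max).
case eqa : (f ord_max - _) => [a|a].
  have -> : `|Num.max (f ord_max) 0|%N = (a + n.+1)%N.
    by rewrite max_l; lia.
  rewrite size_xvec; apply: eq_card => p; rewrite !inE.
  rewrite dominated_xvec /path_vertex xpair_eqE -ups_take.
  have := @count_true_ups p (a + n.+1).
  rewrite size_tuple leqnn => /(_ isT) count_p.
  apply/andP/admissibleP; rewrite cardsT card_ord => -[].
    move=> /andP[_ /eqP ups_p] /forallP le_ups; split=> // k.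
    have [ltk|ltk] := ltnP k (a + n.+1).+1; first exact: (le_ups (Ordinal ltk)).
    rewrite ups_oversize ?size_tuple ?(ltnW ltk) // ups_p.
    by rewrite -[leqRHS]card_ord max_card.
  move=> ups_p le_ups; split; last exact/forallP.
  by move: count_p; rewrite ups_p => /addIn->; rewrite !eqxx.
(* Here [f ord_max < n.+1]: [psi] is 0, and so few steps cannot include [n.+1] up steps. *)
apply/esym/eqP; rewrite cards_eq0; apply/eqP/setP=> p; rewrite !inE.
apply/negP=> /admissibleP[+ _]; rewrite cardsT card_ord => eq_ups.
by have := ups_le p `|Num.max (f ord_max) 0|; rewrite eq_ups; lia.
Qed.

End LatticePaths.

Theorem theorem7 (n : nat) (n_gt0 : (0 < n)%N) (f : complete_graph n -> int)
    (f_mono : forall i j : 'I_n, (i <= j)%N -> f i <= f j) :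
  [/\ is_mc f (psi (xvec f)),
      is_mp f (psi (xvec f))
    & forall m : nat,
        [<-> choosable (extend_map m f);
             paintable (extend_map m f);
             (m < psi (xvec f))%N]].
Proof.
have paintable_ltn m : (m < psi (xvec f))%N -> paintable (extend_map m f).
  case: n n_gt0 f f_mono => // n' _ f' f'_mono; rewrite psi_xvec //.
  move=> ltm; apply: painter_wins_join.
    by move=> w _ /=; rewrite lez_nat max_card.
  have -> : core [set: join_edgeless (complete_graph n'.+1) m] =
      [set: 'I_n'.+1].
    by apply/setP=> i; rewrite !inE.
  (* At the start the critical vertices are among the [m] independent ones. *)
  by apply: leq_ltn_trans ltm; rewrite -[leqRHS]card_ord max_card.
have choosable_ltn m : choosable (extend_map m f) -> (m < psi (xvec f))%N.
  case: n n_gt0 f f_mono {paintable_ltn} => // n' _ f' f'_mono chf.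
  rewrite ltnNge; apply/negP; rewrite psi_xvec // => leNm.
  apply: not_choosable_join leNm chf => i.
  by have := f'_mono i ord_max (leq_ord i); lia.
have paintable_choosable_ext m := @paintable_choosable _ (extend_map m f).
split; last 1 first.
- by move=> m; tfae=> [/choosable_ltn/paintable_ltn||/paintable_ltn] //; auto.
- split=> [/choosable_ltn|m nchm]; first by rewrite ltnn.
  by rewrite leqNgt; apply/negP=> /paintable_ltn; auto.
split=> [/paintable_choosable_ext/choosable_ltn|m npm].
  by rewrite ltnn.
by rewrite leqNgt; apply/negP=> /paintable_ltn.
Qed.
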